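(* Let $\rho: L^1(\mathbb{R}^d)\to\mathbb{C}$ be a linear form satisfying the Taylor compatibility condition (T) stated in the context, and let $\lambda: CS^{\notin\mathbb{Z}}_{\rm c.c}(\mathbb{R}^d)\to\mathbb{C}$ be a linear form which restricts to $\rho$ on $CS^{\notin\mathbb{Z}}_{\rm c.c}(\mathbb{R}^d)\cap CS^{<-d}_{\rm c.c}(\mathbb{R}^d)$. 1. If $\lambda$ is $\mathbb{R}^d$-translation invariant, then it vanishes on partial derivatives: $\lambda(\partial^\beta\sigma)=0$ for all $\beta\neq0$ and all $\sigma\in CS^{\notin\mathbb{Z}}_{\rm c.c}(\mathbb{R}^d)$. 2. If $\lambda$ is $\mathbb{Z}^d$-translation invariant, then its values on derivatives, $\lambda(\partial^\beta\sigma)$ for $\beta\ne0$ and $\sigma\in CS^{\notin\mathbb{Z}}_{\rm c.c}(\mathbb{R}^d)$, are entirely determined by the restriction $\rho$ to $CS^{<-d}_{\rm c.c}(\mathbb{R}^d)$; that is, if $\lambda_1,\lambda_2$ are two $\mathbb{Z}^d$-translation invariant linear forms on $CS^{\notin\mathbb{Z}}_{\rm c.c}(\mathbb{R}^d)$ with the same restriction $\rho$, then $\lambda_1(\partial^\beta\sigma)=\lambda_2(\partial^\beta\sigma)$ for all such $\beta,\sigma$.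
   Context: Symbols. For $a\in\mathbb{C}$, $\mathcal{S}^a_{\rm c.c}(\mathbb{R}^d)$ is the set of smooth functions $\sigma$ on $\mathbb{R}^d$ such that for every multiindex $\beta$ there is $C_\beta$ with $|\partial^\beta\sigma(x)|\le C_\beta(1+|x|)^{{\rm Re}(a)-|\beta|}$. $CS^a_{\rm c.c}(\mathbb{R}^d)\subset\mathcal{S}^a_{\rm c.c}(\mathbb{R}^d)$ is the set of classical symbols of order $a$ with constant coefficients: those $\sigma$ such that for every $N$, $\sigma=\sum_{j=0}^{N-1}\chi\,\sigma_{a-j}+\sigma_{(N)}$ with $\sigma_{a-j}$ positively homogeneous of degree $a-j$ (smooth away from $0$), $\sigma_{(N)}\in\mathcal{S}^{a-N}_{\rm c.c}(\mathbb{R}^d)$, and $\chi$ a smooth cut-off function vanishing near $0$ and equal to $1$ outside the unit ball. Set $CS^{<-d}_{\rm c.c}(\mathbb{R}^d)=\bigcup_{{\rm Re}(a)<-d}CS^a_{\rm c.c}(\mathbb{R}^d)$ and $CS^{\notin\mathbb{Z}}_{\rm c.c}(\mathbb{R}^d)=\bigcup_{a\in\mathbb{C}\setminus\mathbb{Z}}CS^a_{\rm c.c}(\mathbb{R}^d)$. A ''linear form'' on the set $CS^{\notin\mathbb{Z}}_{\rm c.c}(\mathbb{R}^d)$ is a complex-valued map that preserves those linear combinations that lie in the set. Translations. For $p\in\mathbb{R}^d$, $t_p^*\sigma:=\sigma(\cdot+p)$. Condition (T) on $\rho$: for $\sigma\in CS^{<-d}_{\rm c.c}(\mathbb{R}^d)$,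 all $N$ and all $p\in\mathbb{R}^d$, $$\rho(t_p^*\sigma)=\sum_{|\beta|\le N}\rho(\partial^\beta\sigma)\frac{p^\beta}{\beta!}+(N+1)\sum_{|\beta|=N+1}\frac{p^\beta}{\beta!}\int_0^1(1-t)^N\rho\big(\partial^\beta\sigma(\cdot+tp)\big)\,dt .$$ Translation invariance. A linear form $\lambda$ on $CS^{\notin\mathbb{Z}}_{\rm c.c}(\mathbb{R}^d)$ restricting to $\rho$ on $CS^{\notin\mathbb{Z}}_{\rm c.c}(\mathbb{R}^d)\cap CS^{<-d}_{\rm c.c}(\mathbb{R}^d)$ is extended to translated symbols by $$\lambda(t_p^*\sigma):=\sum_{|\beta|\le N}\lambda(\partial^\beta\sigma)\frac{p^\beta}{\beta!}+(N+1)\sum_{|\beta|=N+1}\frac{p^\beta}{\beta!}\int_0^1(1-t)^N\rho\big(\partial^\beta\sigma(\cdot+tp)\big)\,dt$$ for any $N$ large enough that $\partial^\beta\sigma\in L^1(\mathbb{R}^d)$ when $|\beta|=N+1$ (the result does not depend on such $N$). It is called $\mathbb{R}^d$- (resp. $\mathbb{Z}^d$-) translation invariant if for every $\sigma\in CS^{\notin\mathbb{Z}}_{\rm c.c}(\mathbb{R}^d)$, every large enough $N$ and every $p\in\mathbb{R}^d$ (resp. $p\in\mathbb{Z}^d$), $$\sum_{0<|\beta|\le N}\lambda(\partial^\beta\sigma)\frac{p^\beta}{\beta!}+(N+1)\sum_{|\beta|=N+1}\frac{p^\beta}{\beta!}\int_0^1(1-t)^N\rho\big(\partial^\beta\sigma(\cdot+tp)\big)\,dt=0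 .$$ *)

(* Defs.v *)
From HB Require Import structures.
From mathcomp Require Import all_boot all_order all_algebra.
From mathcomp Require Import all_classical all_reals all_analysis.
From mathcomp.real_closed Require Import complex.

Set Implicit Arguments.
Unset Strict Implicit.
Unset Printing Implicit Defensive.

Import Order.TTheory GRing.Theory Num.Theory.
Import numFieldNormedType.Exports.

Local Open Scope classical_set_scope.
Local Open Scope ring_scope.
Local Open Scope complex_scope.

Section Multiindices.
Variable d : nat.

Definition multiindex := {ffun 'I_d -> nat}.

Definition mlen (b : multiindex) : nat := (\sum_i b i)%N.

Definition mfact (b : multiindex) : nat := (\prod_i (b i)`!)%N.

Definition mpow (R : realType) (p : 'rV[R]_d) (b : multiindex) : R :=
  \prod_i p ord0 i ^+ b i.

Definition multi0 : multiindex := [ffun=> 0%N].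

(* The sum of F b over |b| = k; the entries of such a b are at most k. *)
Definition sum_mlen (R : realType) (k : nat) (F : multiindex -> R[i]) : R[i] :=
  \sum_(b : {ffun 'I_d -> 'I_k.+1} | mlen [ffun i => val (b i)] == k)
    F [ffun i => val (b i)].

End Multiindices.

Section Smoothness.
Variables (R : realType) (d : nat).
Implicit Types (g : 'rV[R]_d -> R) (f : 'rV[R]_d -> R[i]).

(* The iterated partial derivative d_{s_0} d_{s_1} ... g. *)
Definition partials (s : seq 'I_d) g : 'rV[R]_d -> R :=
  foldr (fun i h x => 'D_(delta_mx ord0 i) h x) g s.

(* C^infty on U, which is meant to be open: the partial derivatives of all
   orders exist and are continuous at the points of U. *)
Definition smooth_on (U : set 'rV[R]_d) g : Prop :=
  forall (s : seq 'I_d) (x : 'rV[R]_d), U x ->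
    {for x, continuous (partials s g)} /\
    forall i : 'I_d, derivable (partials s g) x (delta_mx ord0 i).

Definition csmooth_on (U : set 'rV[R]_d) f : Prop :=
  smooth_on U (fun x => complex.Re (f x)) /\ smooth_on U (fun x => complex.Im (f x)).

(* Each index i is listed b i times, in increasing order. *)
Definition mseq (b : multiindex d) : seq 'I_d :=
  flatten [seq nseq (b i) i | i <- enum 'I_d].

Definition pderiv (b : multiindex d) f : 'rV[R]_d -> R[i] := fun x =>
  partials (mseq b) (fun y => complex.Re (f y)) x
    +i* partials (mseq b) (fun y => complex.Im (f y)) x.

Definition translate (p : 'rV[R]_d) f : 'rV[R]_d -> R[i] := fun x => f (x + p).

Definition enorm (x : 'rV[R]_d) : R := Num.sqrt (\sum_i x ord0 i ^+ 2).

End Smoothness.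

Section Symbols.
Variables (R : realType) (d : nat).
Implicit Types (a : R[i]) (f : 'rV[R]_d -> R[i]).

Definition symbol a f : Prop :=
  csmooth_on setT f /\
  forall b : multiindex d, exists C : R, forall x : 'rV[R]_d,
    Normc.normc (pderiv b f x) <= C * (1 + enorm x) `^ (complex.Re a - (mlen b)%:R).

(* t ^ a for t > 0 and a complex exponent a. *)
Definition cpow (t : R) a : R[i] :=
  (t `^ complex.Re a)%:C * (cos (complex.Im a * ln t) +i* sin (complex.Im a * ln t)).

Definition pos_homogeneous a f : Prop :=
  forall (t : R) (x : 'rV[R]_d), 0 < t -> x != 0 ->
    f (t *: x) = cpow t a * f x.

Definition cutoff (chi : 'rV[R]_d -> R) : Prop :=
  [/\ smooth_on setT chi,
      \forall x \near (0 : 'rV[R]_d), chi x = 0 &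
      forall x : 'rV[R]_d, 1 <= enorm x -> chi x = 1].

(* The homogeneous components s j are determined by f outside the origin, so
   that a single sequence s serves all the expansion lengths N. *)
Definition classical_symbol a f : Prop :=
  symbol a f /\
  exists chi : 'rV[R]_d -> R, cutoff chi /\
  exists s : nat -> 'rV[R]_d -> R[i],
    (forall j, csmooth_on [set x | x != 0] (s j) /\
               pos_homogeneous (a - j%:R) (s j)) /\
    forall N : nat,
      symbol (a - N%:R) (fun x => f x - \sum_(j < N) (chi x)%:C * s j x).

Definition CS_lt_minus_d : set ('rV[R]_d -> R[i]) :=
  [set f | exists a : R[i], complex.Re a < - d%:R /\ classical_symbol a f].

Definition CS_nonint : set ('rV[R]_d -> R[i]) :=
  [set f | exists a : R[i],
     (forall m : int, a != m%:~R) /\ classical_symbol a f].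

End Symbols.

Section LebesgueSpace.
Variable R : realType.

Definition tcons (n : nat) (z : n.-tuple (measurableTypeR R) * measurableTypeR R)
  : n.+1.-tuple (measurableTypeR R) := [tuple of z.2 :: z.1].

Lemma measurable_tcons (n : nat) : measurable_fun setT (@tcons n).
Proof. exact: measurable_cons. Qed.

Fixpoint lebesgue_tuple (n : nat) : set (n.-tuple (measurableTypeR R)) -> \bar R :=
  match n with
  | 0 => dirac [tuple]
  | m.+1 => pushforward (@lebesgue_tuple m \x lebesgue_measure)%E (@tcons m)
  end.

Lemma lebesgue_tuple_isMeasure (n : nat) :
  [/\ @lebesgue_tuple n set0 = 0%E,
      forall A, (0 <= @lebesgue_tuple n A)%E &
      semi_sigma_additive (@lebesgue_tuple n)].
Proof.
elim: n => [|n [mu0 mu_ge0 mu_add]] /=.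
  by split=> //; exact: measure_semi_sigma_additive.
pose M := isMeasure.Build _ _ _ (@lebesgue_tuple n) mu0 mu_ge0 mu_add.
pose mu : {measure set (n.-tuple (measurableTypeR R)) -> \bar R} :=
  HB.pack (@lebesgue_tuple n) M.
pose nu := measure_function_pushforward__canonical__measure_function_Measure
  (mu \x @lebesgue_measure R)%E (@measurable_tcons n).
split; first exact: (measure0 nu).
- exact: (measure_ge0 nu).
- exact: (@measure_semi_sigma_additive _ _ _ nu).
Qed.

HB.instance Definition _ (n : nat) := isMeasure.Build _ _ _ (@lebesgue_tuple n)
  (let: And3 p _ _ := lebesgue_tuple_isMeasure n in p)
  (let: And3 _ p _ := lebesgue_tuple_isMeasure n in p)
  (let: And3 _ _ p := lebesgue_tuple_isMeasure n in p).

Lemma lebesgue_tuple_box (n : nat) (A : 'I_n -> set (measurableTypeR R)) :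
  (forall i, measurable (A i)) ->
  lebesgue_tuple [set t : n.-tuple (measurableTypeR R) | forall i, A i (tnth t i)]
  = (\prod_(i < n) lebesgue_measure (A i))%E.
Proof.
elim: n A => [|n IHn] A mA /=.
  rewrite big_ord0 diracE mem_set//.
  by case.
rewrite big_ord_recl muleC -IHn => [|i]; last exact: mA.
rewrite -product_measure1E //; last first.
  rewrite (_ : mkset _ = \bigcap_(i in [set: 'I_n])
    ((fun t : n.-tuple (measurableTypeR R) => tnth t i) @^-1` A (lift ord0 i))).
    apply: fin_bigcap_measurable => // i _; rewrite -[X in measurable X]setTI.
    exact: measurable_tnth.
  by apply/seteqP; split=> [t At i _|t At i]; [exact: At|exact: At].
congr product_measure1; apply/seteqP; split=> [[t x] /= Atx|[t x] /= [At Ax] i].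
  split; last exact: (Atx ord0).
  by move=> i; move: (Atx (lift ord0 i)); rewrite tnthS.
case: (unliftP ord0 i) => [j ->|-> //].
by rewrite tnthS; exact: At.
Qed.

Variable d : nat.
Implicit Types f g : 'rV[R]_d -> R[i].

Definition row_of_tuple (t : d.-tuple (measurableTypeR R)) : 'rV[R]_d :=
  \row_i tnth t i.

(* Borel representatives suffice: every class of L^1(R^d) contains one. *)
Definition L1 f : Prop :=
  (@lebesgue_tuple d).-integrable setT
    (EFin \o (fun t => complex.Re (f (row_of_tuple t)))) /\
  (@lebesgue_tuple d).-integrable setT
    (EFin \o (fun t => complex.Im (f (row_of_tuple t)))).

Definition ae_equal f g : Prop :=
  {ae @lebesgue_tuple d, forall t, f (row_of_tuple t) = g (row_of_tuple t)}.

(* A linear form on L^1(R^d), as a function of representatives; its values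
   outside L^1(R^d) are irrelevant. *)
Definition L1_linear_form (rho : ('rV[R]_d -> R[i]) -> R[i]) : Prop :=
  (forall (c : R[i]) f g, L1 f -> L1 g ->
     rho (fun x => c * f x + g x) = c * rho f + rho g) /\
  (forall f g, L1 f -> L1 g -> ae_equal f g -> rho f = rho g).

End LebesgueSpace.

Section TranslationInvariance.
Variables (R : realType) (d : nat).
Implicit Types (f : 'rV[R]_d -> R[i]) (rho lambda : ('rV[R]_d -> R[i]) -> R[i]).

(* CS_nonint is not a vector space and partial sums may leave it, so that
   preservation of combinations of two terms would not be enough. *)
Definition CS_nonint_linear_form lambda : Prop :=
  forall (n : nat) (c : 'I_n -> R[i]) (f : 'I_n -> 'rV[R]_d -> R[i]),
    (forall i, CS_nonint (f i)) ->
    CS_nonint (fun x => \sum_(i < n) c i * f i x) ->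
    lambda (fun x => \sum_(i < n) c i * f i x) = \sum_(i < n) c i * lambda (f i).

Definition restricts_to lambda rho : Prop :=
  forall f, CS_nonint f -> CS_lt_minus_d f -> lambda f = rho f.

Definition integrable01 (h : R -> R[i]) : Prop :=
  (@lebesgue_measure R).-integrable `[0, 1]
    (EFin \o (fun t => complex.Re (h t))) /\
  (@lebesgue_measure R).-integrable `[0, 1]
    (EFin \o (fun t => complex.Im (h t))).

Definition integral01 (h : R -> R[i]) : R[i] :=
  (\int[@lebesgue_measure R]_(t in `[0, 1]) complex.Re (h t))
    +i* (\int[@lebesgue_measure R]_(t in `[0, 1]) complex.Im (h t)).

Definition mcoef (p : 'rV[R]_d) (b : multiindex d) : R[i] :=
  (mpow p b / (mfact b)%:R)%:C.

Definition remainder_integrand rho f (N : nat) (p : 'rV[R]_d)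
    (b : multiindex d) (t : R) : R[i] :=
  ((1 - t) ^+ N)%:C * rho (translate (t *: p) (pderiv b f)).

Definition taylor_remainder rho f (N : nat) (p : 'rV[R]_d) : R[i] :=
  N.+1%:R * sum_mlen N.+1 (fun b : multiindex d =>
    mcoef p b * integral01 (remainder_integrand rho f N p b)).

(* The integral above is total, so the existence of the integrals occurring
   in Taylor's formula is part of the condition. *)
Definition taylor_compatible rho : Prop :=
  forall f, CS_lt_minus_d f -> forall (N : nat) (p : 'rV[R]_d),
    (forall b : multiindex d, mlen b = N.+1 ->
       integrable01 (remainder_integrand rho f N p b)) /\
    rho (translate p f) =
      \sum_(0 <= k < N.+1)
        sum_mlen k (fun b : multiindex d => rho (pderiv b f) * mcoef p b)
      + taylor_remainder rho f N p.

Definition translation_invariant (P : set 'rV[R]_d) rho lambda : Prop :=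
  forall f, CS_nonint f ->
  exists N0 : nat, forall N : nat, (N0 <= N)%N ->
  forall p : 'rV[R]_d, P p ->
    \sum_(1 <= k < N.+1)
      sum_mlen k (fun b : multiindex d => lambda (pderiv b f) * mcoef p b)
    + taylor_remainder rho f N p = 0.

Definition integer_points : set 'rV[R]_d :=
  [set p | forall i, p ord0 i \is a Num.int].

End TranslationInvariance.

(* Main.v *)
Require Import Defs.
From mathcomp Require Import all_boot all_order all_algebra.
From mathcomp Require Import all_classical all_reals all_analysis.
From mathcomp.real_closed Require Import complex.
From mathcomp Require Import ring lra.
Import Order.TTheory GRing.Theory Num.Theory.
Import numFieldNormedType.Exports.
Set Implicit Arguments.
Unset Strict Implicit.
Unset Printing Implicit Defensive.
Local Open Scope classical_set_scope.
Local Open Scope ring_scope.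
Local Open Scope complex_scope.

(** For a fixed symbol f and a large order N, translation invariance says that
a function of p vanishes.  Its first part is a polynomial in p without constant
term, whose coefficients are the values lambda (d^b f) / b! for
0 < |b| <= N; its second part is the Taylor remainder, which involves only rho.

Two forms that are invariant under Z^d and share rho have the same remainder.
Subtracting, one gets a polynomial vanishing at all integer points, so its
coefficients vanish ([taylor_poly_eq0]) and the two forms agree on d^b f.

If lambda is R^d-invariant, the remainder itself is a homogeneous polynomial of
degree N + 1 in p.  Indeed, for |b| = N + 1 large, tau = d^b f has order below
-d, so that lambda and rho agree on tau and on its derivatives; comparing
Taylor's formula for rho with the invariance of lambda at tau gives
rho (tau (. + q)) = rho tau for all q ([rho_translate]).  The integrals in the
remainder are then independent of p.  Being of higher degree, the remainder
cannot cancel the first part, and the coefficients lambda (d^b f) vanish.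

The analytic input is that differentiation maps classical symbols of order a
to classical symbols of order a - 1 ([classical_symbol_cpd]): this makes the
derivatives of f again legitimate arguments, of non-integer order, and of order
below -d after enough derivatives.  Estimates on d^b (d_i f) follow from those
on f because partial derivatives commute ([derive_comm]).  The homogeneous
components are differentiated termwise by the chain rule ([is_derive_scale]).
When a derivative falls on the cutoff instead, the resulting term is smooth and
supported in the cube [-1, 1]^d, hence a symbol of every order
([compactly_supported_rsymbol]). *)

(** * Smooth functions on an open set *)

Section SmoothFunctions.
Variables (R : realType) (d : nat).
Implicit Types (U : set 'rV[R]_d) (g h : 'rV[R]_d -> R) (s : seq 'I_d).

Definition pd (i : 'I_d) g : 'rV[R]_d -> R :=
  fun x => 'D_(delta_mx ord0 i) g x.

Lemma partials_cat s1 s2 g : partials (s1 ++ s2) g = partials s1 (partials s2 g).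
Proof. exact: foldr_cat. Qed.

Lemma smooth_partials U s g : smooth_on U g -> smooth_on U (partials s g).
Proof. by move=> gS s' x Ux; rewrite -partials_cat; exact: gS. Qed.

Lemma open_eq_near U g h x : open U -> (forall y, U y -> g y = h y) -> U x ->
  \near x, g x = h x.
Proof.
by move=> oU gh Ux; apply: filterS (open_nbhs_nbhs (conj oU Ux)) => y /gh.
Qed.

Lemma near_eq_continuous g h x : (\near x, g x = h x) ->
  {for x, continuous g} -> {for x, continuous h}.
Proof.
move=> gh; rewrite /prop_for /continuous_at (nbhs_singleton gh).
by move=> gc; refine (cvg_trans (near_eq_cvg _) gc).
Qed.

(** A coinduction principle: derivatives of every order stay in G, so regularity
of the members of G is all that is needed.  It avoids explicit formulas, such as
the iterated Leibniz rule, for derivatives of high order. *)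
Lemma smooth_coind U (G : set ('rV[R]_d -> R)) : open U ->
  (forall g, G g -> forall x, U x ->
     {for x, continuous g} /\ forall i, derivable g x (delta_mx ord0 i)) ->
  (forall g i, G g -> exists2 h, G h & forall x, U x -> pd i g x = h x) ->
  forall g, G g -> smooth_on U g.
Proof.
move=> oU Gder Gpd g Gg s x Ux.
have [h Gh gh] : exists2 h, G h & forall x, U x -> partials s g x = h x.
  elim: s {x Ux} => [|i s [h Gh gh]]; first by exists g.
  have [k Gk hk] := Gpd h i Gh; exists k => // x Ux.
  by rewrite -hk//; apply: near_eq_derive; exact: open_eq_near Ux.
have [hc hd] := Gder h Gh x Ux.
have hg : \near x, h x = partials s g x.
  by apply: (open_eq_near oU) => // y /gh.
split; last by move=> i; exact: near_eq_derivable (hd i).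
exact: near_eq_continuous hg hc.
Qed.

(** Sums and products are generated together because the derivative of a
product is a sum of products: this makes the set closed under derivation, as
[smooth_coind] requires. *)
Inductive smooth_algebra U : ('rV[R]_d -> R) -> Prop :=
| smooth_algebra_gen g : smooth_on U g -> smooth_algebra U g
| smooth_algebra_cst c : smooth_algebra U (cst c)
| smooth_algebraD g h : smooth_algebra U g -> smooth_algebra U h ->
    smooth_algebra U (g + h)
| smooth_algebraM g h : smooth_algebra U g -> smooth_algebra U h ->
    smooth_algebra U (g * h).

Lemma smooth_algebra_derivable U g : smooth_algebra U g -> forall x, U x ->
  {for x, continuous g} /\ forall i, derivable g x (delta_mx ord0 i).
Proof.
elim=> {g} [g gS x Ux|c x _|g h _ IHg _ IHh x Ux|g h _ IHg _ IHh x Ux].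
- exact: (gS [::]).
- split=> [|i]; first exact: cst_continuous.
  exact: derivable_cst.
- have [[gc gd] [hc hd]] := (IHg x Ux, IHh x Ux).
  split=> [|i]; first exact: continuousD.
  exact: derivableD.
- have [[gc gd] [hc hd]] := (IHg x Ux, IHh x Ux).
  split=> [|i]; first exact: continuousM.
  exact: derivableM.
Qed.

Lemma smooth_algebraP U g : open U -> smooth_algebra U g -> smooth_on U g.
Proof.
move=> oU; apply: smooth_coind => // [|{}g i]; first exact: smooth_algebra_derivable.
elim=> {g} [g gS|c|g h gA [g' g'A gg'] hA [h' h'A hh']
           |g h gA [g' g'A gg'] hA [h' h'A hh']].
- exists (pd i g) => //; apply: smooth_algebra_gen.
  exact: (smooth_partials [:: i]).
- exists (cst 0); first exact: smooth_algebra_cst.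
  by move=> x _; exact: derive_cst.
- exists (g' + h'); first exact: smooth_algebraD.
  move=> x Ux; rewrite /pd deriveD -?[in RHS]gg' -?[in RHS]hh'//.
  + by rewrite fctE -gg'// -hh'.
  + by have [] := smooth_algebra_derivable gA Ux.
  + by have [] := smooth_algebra_derivable hA Ux.
- exists (g * h' + h * g').
    by apply: smooth_algebraD; exact: smooth_algebraM.
  move=> x Ux; rewrite /pd deriveM.
  + by rewrite !fctE -gg'// -hh'.
  + by have [] := smooth_algebra_derivable gA Ux.
  + by have [] := smooth_algebra_derivable hA Ux.
Qed.

Lemma smooth_cst U c : open U -> smooth_on U (cst c).
Proof. by move=> oU; apply: smooth_algebraP => //; exact: smooth_algebra_cst. Qed.

Lemma smoothD U g h : open U -> smooth_on U g -> smooth_on U h ->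
  smooth_on U (g + h).
Proof.
by move=> oU gS hS; apply: smooth_algebraP => //; apply: smooth_algebraD;
  exact: smooth_algebra_gen.
Qed.

Lemma smoothM U g h : open U -> smooth_on U g -> smooth_on U h ->
  smooth_on U (g * h).
Proof.
by move=> oU gS hS; apply: smooth_algebraP => //; apply: smooth_algebraM;
  exact: smooth_algebra_gen.
Qed.

Lemma smooth_eq U g h : open U -> (forall x, U x -> g x = h x) ->
  smooth_on U g -> smooth_on U h.
Proof.
move=> oU gh gS.
apply: (@smooth_coind U [set h | exists2 g, smooth_on U g & forall x, U x -> g x = h x]);
  last by exists g.
- exact: oU.
- move=> k [g' g'S g'k] x Ux.
  have [gc gd] := g'S [::] x Ux.
  have gk := open_eq_near oU g'k Ux.
  split; last by move=> i; exact: near_eq_derivable (gd i).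
  exact: near_eq_continuous gk gc.
- move=> k i [g' g'S g'k]; exists (pd i k) => //; exists (pd i g').
    exact: (smooth_partials [:: i]).
  by move=> x Ux; apply: near_eq_derive; exact: open_eq_near Ux.
Qed.

Lemma derivable_smooth U g i x : smooth_on U g -> U x ->
  derivable g x (delta_mx ord0 i).
Proof. by move=> gS Ux; have [_] := gS [::] x Ux; exact. Qed.

Lemma pd_add U g h i x : smooth_on U g -> smooth_on U h -> U x ->
  pd i (g + h) x = pd i g x + pd i h x.
Proof. by move=> gS hS Ux; apply: deriveD; exact: derivable_smooth Ux. Qed.

Lemma pd_mul U g h i x : smooth_on U g -> smooth_on U h -> U x ->
  pd i (g * h) x = g x * pd i h x + h x * pd i g x.
Proof. by move=> gS hS Ux; apply: deriveM; exact: derivable_smooth Ux. Qed.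

End SmoothFunctions.

(** * Directional derivatives: symmetry and scaling *)

Section Schwarz.
Variables (R : realType) (V : normedModType R).
Implicit Types (g : V -> R) (x y v w : V).

(** Reduces a directional derivative to a derivative in one variable, where
the mean value theorem and the chain rule are available. *)
Lemma is_derive_line g y v (s l : R) :
  is_derive s 1 (fun t => g (y + t *: v)) l <-> is_derive (y + s *: v) v g l.
Proof.
have E : (fun h : R => h^-1 *: ((fun t => g (y + t *: v)) (h *: 1 + s)
                       - (fun t => g (y + t *: v)) s)) =
         (fun h => h^-1 *: (g (h *: v + (y + s *: v)) - g (y + s *: v))).
  by apply/funext => h; rewrite /= [h%:A]mulr1 scalerDl addrCA.
by split=> -[]; rewrite /derivable /derive /= => gd gl; split;
  rewrite /derivable /derive /= (E, esym E).
Qed.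

Lemma MVT_line g y v (h : R) : 0 < h -> (forall z, derivable g z v) ->
  exists2 s, 0 < s < h & g (y + h *: v) - g y = 'D_v g (y + s *: v) * h.
Proof.
move=> h0 gd.
have gl (s : R) : is_derive s 1 (fun t => g (y + t *: v)) ('D_v g (y + s *: v)).
  by apply/is_derive_line; exact: derivableP.
have [|s] := @MVT R _ _ 0 h h0 (fun s _ => gl s).
  apply: continuous_subspaceT => s.
  by apply: differentiable_continuous; apply/derivable1_diffP; have [] := gl s.
rewrite in_itv/= scale0r addr0 subr0 => s0h E; exists s => //.
Qed.

(** The second difference of g over the parallelogram spanned by h v and h w
is obtained by applying the mean value theorem first along v, to the increment
of g in direction w, and then along w.  The left-hand side is symmetric in v
and w, which is what makes second derivatives commute. *)
Lemma second_difference_MVT g x v w (h : R) : 0 < h ->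
  (forall z, derivable g z v) -> (forall z, derivable ('D_v g) z w) ->
  exists s t, [/\ 0 < s < h, 0 < t < h &
    g (x + h *: v + h *: w) - g (x + h *: v) - (g (x + h *: w) - g x) =
    'D_w ('D_v g) (x + s *: v + t *: w) * h * h].
Proof.
move=> h0 gv gw.
pose k z := g (h *: w + z) - g z.
have kd z : is_derive z v k ('D_v g (h *: w + z) - 'D_v g z).
  have gs : is_derive z v (fun y => g (h *: w + y)) ('D_v g (h *: w + z)).
    have E : (fun e : R => e^-1 *: (g (h *: w + (e *: v + z)) - g (h *: w + z))) =
      (fun e : R => e^-1 *: (g (e *: v + (h *: w + z)) - g (h *: w + z))).
      by apply/funext => e; rewrite addrCA.
    split; rewrite /derivable /derive /= E//.
    exact: gv.
  by apply: is_deriveB => //; apply: derivableP.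
have [|s sh] := @MVT_line k x v h h0.
  by move=> z; have [] := kd z.
have [_ ->] := kd (x + s *: v).
have [t th] := MVT_line (x + s *: v) h0 gw.
rewrite (addrC (_ + _) (h *: w)) => -> E.
exists s, t; split=> //; rewrite -E /k; congr (g _ - _ - (g _ - _)); exact: addrC.
Qed.

(** Symmetry of second derivatives.  Both mixed derivatives, taken at points
of a small parallelogram at x, equal the same second difference divided by the
square of h; continuity at x then identifies their values at x. *)
Lemma derive_comm g x v w :
  (forall z, derivable g z v) -> (forall z, derivable g z w) ->
  (forall z, derivable ('D_v g) z w) -> (forall z, derivable ('D_w g) z v) ->
  {for x, continuous ('D_w ('D_v g))} -> {for x, continuous ('D_v ('D_w g))} ->
  'D_w ('D_v g) x = 'D_v ('D_w g) x.
Proof.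
move=> gv gw gvw gwv cvw cwv; apply/eqP; rewrite -subr_eq0 -normr_le0.
apply/ler_addgt0Pr => e e0; rewrite add0r.
have e20 : 0 < e / 2 by rewrite divr_gt0.
have [r r0 rP] : exists2 r : R, 0 < r & forall y, `|x - y| < r ->
    `|'D_w ('D_v g) x - 'D_w ('D_v g) y| < e / 2 /\
    `|'D_v ('D_w g) x - 'D_v ('D_w g) y| < e / 2.
  have close (k : V -> R) : {for x, continuous k} ->
      \forall y \near x, `|k x - k y| < e / 2.
    by move=> ck; exact: (cvgrPdist_lt _ _).1 ck _ e20.
  have N : nbhs x [set y | `|'D_w ('D_v g) x - 'D_w ('D_v g) y| < e / 2 /\
    `|'D_v ('D_w g) x - 'D_v ('D_w g) y| < e / 2].
    by exact: (filterI (close _ cvw) (close _ cwv)).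
  move/nbhs_ballP: N => [r r0 rP]; exists r => // y xy.
  by apply: rP; rewrite -ball_normE.
(* A parallelogram with sides h v and h w is contained in the ball of radius r. *)
pose D := 1 + `|v| + `|w|.
have D0 : 0 < D by rewrite /D -addrA ltr_pwDl// addr_ge0.
pose h := r / D.
have h0 : 0 < h by rewrite divr_gt0.
have small (s t : R) : 0 < s < h -> 0 < t < h -> `|s *: v + t *: w| < r.
  move=> /andP[s0 sh] /andP[t0 th]; rewrite (le_lt_trans (ler_normD _ _))// !normrZ.
  rewrite !gtr0_norm//.
  rewrite (@le_lt_trans _ _ (h * `|v| + h * `|w|))//.
    by rewrite lerD// ler_wpM2r// ltW.
  by rewrite -mulrDr /h mulrAC ltr_pdivrMr// ltr_pM2l// /D -addrA ltrDr.
have dist (y : V) : `|x - (x + y)| = `|y| by rewrite opprD addNKr normrN.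
have [s [t [s0h t0h E1]]] := second_difference_MVT x h0 gv gvw.
have [s' [t' [s'0h t'0h E2]]] := second_difference_MVT x h0 gw gwv.
have [] := rP (x + s *: v + t *: w); first by rewrite -addrA dist small.
have [] := rP (x + s' *: w + t' *: v).
  by rewrite -addrA (addrC (s' *: w)) dist small.
move: E1 E2; rewrite (addrAC x (h *: w)).
move: ('D_w ('D_v g) (_ + _ + _)) ('D_v ('D_w g) (_ + _ + _)) => A B E1 E2.
have swap (p q r' u : R) : p - q - (r' - u) = p - r' - (q - u) by ring.
have <- : A = B.
  apply: (mulIf (lt0r_neq0 h0)); apply: (mulIf (lt0r_neq0 h0)).
  by rewrite -E1 -E2 swap.
move: ('D_w _ x) ('D_v _ x) => X Y _ YA XA _.
have -> : X - Y = (X - A) - (Y - A) by ring.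
by rewrite (le_trans (ler_normB _ _))// ltW// (splitr e) ltrD.
Qed.

Lemma is_derive_scale g x v (t l : R) : is_derive (t *: x) v g l ->
  is_derive x v (fun y => g (t *: y)) (t * l).
Proof.
rewrite -[t *: x]addr0 -(scale0r v) => /is_derive_line gl.
rewrite -[x]addr0 -(scale0r v); apply/is_derive_line.
have -> : (fun e : R => g (t *: (x + e *: v))) =
    (fun e => g (t *: x + e *: v)) \o ( *%R t).
  by apply/funext => e /=; rewrite scalerDr scalerA.
rewrite mulrC; apply: is_derive1_comp.
  by rewrite mulr0.
by apply: is_derive_eq; exact: mulr1.
Qed.

End Schwarz.

(** * Iterated partial derivatives *)

Section IteratedPartials.
Variables (R : realType) (d : nat).
Implicit Types (U : set 'rV[R]_d) (g h : 'rV[R]_d -> R) (s : seq 'I_d).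

Lemma pd_comm i j g : smooth_on setT g -> pd i (pd j g) = pd j (pd i g).
Proof.
move=> gS; apply/funext => x.
have der s k z : derivable (partials s g) z (delta_mx ord0 k).
  exact: (gS s z I).2.
apply: derive_comm.
- exact: der [::] j.
- exact: der [::] i.
- exact: der [:: j] i.
- exact: der [:: i] j.
- exact: (gS [:: i; j] x I).1.
- exact: (gS [:: j; i] x I).1.
Qed.

Lemma partials_perm s s' g : smooth_on setT g -> perm_eq s s' ->
  partials s g = partials s' g.
Proof.
move=> gS.
have front s1 i s2 : partials (s1 ++ i :: s2) g = partials (i :: s1 ++ s2) g.
  elim: s1 => //= j s1 ->.
  by apply: pd_comm; exact: smooth_partials.
elim: s s' => [|i s IHs] s'; first by rewrite perm_sym => /perm_nilP->.
move=> ss'; have is' : i \in s' by rewrite -(perm_mem ss') mem_head.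
case/path.splitPr: is' ss' => s1 s2 ss'; rewrite front /=.
rewrite (IHs (s1 ++ s2))//.
by rewrite -(perm_cons i) (perm_trans ss')// -cat_rcons -cats1 -catA perm_catCA.
Qed.

Lemma count_mseq (b : multiindex d) i : count_mem i (mseq b) = b i.
Proof.
rewrite count_flatten -map_comp sumnE big_map big_enum/= (bigD1 i)//= big1.
  by rewrite count_nseq /= eqxx mul1n addn0.
by move=> j ji; rewrite count_nseq /= (negbTE ji).
Qed.

Lemma size_mseq (b : multiindex d) : size (mseq b) = mlen b.
Proof.
rewrite size_flatten /shape -map_comp sumnE big_map big_enum/=.
by apply: eq_bigr => i _; rewrite size_nseq.
Qed.

(** Any list of directions is a rearrangement of the sorted list attached to a
multiindex, so that estimates known for multiindices hold for all iterated
derivatives, in whatever order they are taken. *)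
Lemma perm_mseq s : perm_eq s (mseq [ffun i => count_mem i s]).
Proof. by apply/allP => i _ /=; rewrite count_mseq ffunE. Qed.

Lemma partials_eq U s g h : open U -> (forall x, U x -> g x = h x) ->
  forall x, U x -> partials s g x = partials s h x.
Proof.
move=> oU gh; elim: s => [//|i s IHs] x Ux /=.
by apply: near_eq_derive; exact: open_eq_near Ux.
Qed.

Lemma partials0 s : partials s (cst 0 : 'rV[R]_d -> R) = cst 0.
Proof.
elim: s => //= i s ->; apply/funext => x; exact: derive_cst.
Qed.

Lemma partialsD s g h : smooth_on setT g -> smooth_on setT h ->
  partials s (g + h) = partials s g + partials s h.
Proof.
move=> gS hS; elim: s => //= i s ->; apply/funext => x.
exact: (pd_add i (smooth_partials s gS) (smooth_partials s hS) (I : setT x)).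
Qed.

End IteratedPartials.

(** * Symbol estimates for real-valued functions *)

Section RealSymbols.
Variables (R : realType) (d : nat).
Implicit Types (g h : 'rV[R]_d -> R) (s : seq 'I_d) (r : R).

(** Real-valued symbols of order r, with estimates indexed by lists of
directions rather than by multiindices: in this form the estimates for pd i g
are literally some of those for g. *)
Definition rsymbol r g := smooth_on setT g /\
  forall s, exists C, forall x,
    `|partials s g x| <= C * (1 + enorm x) `^ (r - (size s)%:R).

Lemma enorm_ge0 (x : 'rV[R]_d) : 0 <= enorm x.
Proof. exact: sqrtr_ge0. Qed.

(** The modulus is equivalent to the sum of the absolute values of the two
parts, and every list of directions may be sorted by [perm_mseq]. *)
Lemma symbolP (a : R[i]) f : symbol a f <->
  rsymbol (complex.Re a) (fun x => complex.Re (f x)) /\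
  rsymbol (complex.Re a) (fun x => complex.Im (f x)).
Proof.
split=> [[[reS imS] fb]|[[reS reb] [imS imb]]].
  split; split=> // s; have [C Cb] := fb [ffun i => count_mem i s];
    exists C => x; have := Cb x; rewrite -size_mseq -(perm_size (perm_mseq s));
    apply: le_trans; rewrite /pderiv/=.
    rewrite -(partials_perm reS (perm_mseq s)) -sqrtr_sqr ler_wsqrtr//.
    by rewrite lerDl sqr_ge0.
  rewrite -(partials_perm imS (perm_mseq s)) -sqrtr_sqr ler_wsqrtr//.
  by rewrite lerDr sqr_ge0.
split=> // b; have [C Cb] := reb (mseq b); have [D Db] := imb (mseq b).
exists (C + D) => x; have := Cb x; have := Db x; rewrite size_mseq mulrDl /pderiv/=.
set u := partials _ _ x; set v := partials _ _ x => vb ub.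
apply: le_trans (lerD ub vb).
rewrite -(@ger0_norm _ (`|_| + `|_|)) ?addr_ge0// -sqrtr_sqr ler_wsqrtr//.
rewrite sqrrD !real_normK ?num_real// lerD2r lerDl.
by rewrite mulrn_wge0// mulr_ge0.
Qed.

Lemma rsymbolD r g h : rsymbol r g -> rsymbol r h -> rsymbol r (g + h).
Proof.
move=> [gS gb] [hS hb]; split=> [|s]; first exact: (smoothD openT gS hS).
have [[C Cb] [D Db]] := (gb s, hb s); exists (C + D) => x.
rewrite partialsD//= mulrDl.
by rewrite (le_trans (ler_normD _ _))// lerD.
Qed.

Lemma rsymbol_pd r g i : rsymbol r g -> rsymbol (r - 1) (pd i g).
Proof.
move=> [gS gb]; split=> [|s]; first exact: (smooth_partials [:: i]).
have [C Cb] := gb (s ++ [:: i]); exists C => x.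
have := Cb x; rewrite partials_cat size_cat /= natrD.
by rewrite opprD addrA addrAC.
Qed.

(** The complement of the cube [-1, 1]^d stands in for the outside of the unit
ball: cutoffs equal 1 there, it is visibly open, and the cube itself, being a
product of segments, is compact. *)
Definition off_cube : set 'rV[R]_d := [set x | exists i, 1 < `|x ord0 i|].

Lemma open_off_cube : open off_cube.
Proof.
have -> : off_cube = \bigcup_(i in setT)
    ((fun x : 'rV[R]_d => `|x ord0 i|) @^-1` [set t | 1 < t]).
  by apply/seteqP; split=> x [j]; exists j.
apply: bigcup_open => i _; apply: open_comp; last exact: open_gt.
move=> x _; apply: (@continuous_comp _ _ _ (fun x : 'rV[R]_d => x ord0 i) Num.norm).
  exact: coord_continuous.
exact: norm_continuous.
Qed.

Lemma off_cube_enorm x : off_cube x -> 1 <= enorm x.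
Proof.
move=> [i xi]; rewrite -sqrtr1 ler_wsqrtr// (bigD1 i)//=.
rewrite -real_normK ?num_real// (@le_trans _ _ (`|x ord0 i| ^+ 2))//.
  by rewrite -[leLHS](expr1n _ 2) ler_pXn2r ?nnegrE// ltW.
by rewrite lerDl sumr_ge0// => j _; exact: sqr_ge0.
Qed.

Lemma cube_enorm x : ~ off_cube x -> enorm x <= Num.sqrt d%:R.
Proof.
move=> xK; rewrite ler_wsqrtr// -[X in X%:R](card_ord d) -sumr_const.
apply: ler_sum => i _; rewrite -real_normK ?num_real// -[leRHS](expr1n _ 2).
rewrite ler_pXn2r ?nnegrE// leNgt; apply/negP => xi; apply: xK.
by exists i.
Qed.

(** On the cube the derivatives of h are bounded by compactness, while any power
of 1 + |x|, of positive or negative exponent, is bounded below there. *)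
Lemma compactly_supported_rsymbol r h : smooth_on setT h ->
  (forall x, off_cube x -> h x = 0) -> rsymbol r h.
Proof.
move=> hS h0; split=> // s.
pose K : set 'rV[R]_d := [set v | forall i, `[-1, 1]%classic (v ord0 i)].
have KP x : K x <-> ~ off_cube x.
  split=> [Kx [i xi]|xK i /=].
    by move: (Kx i) => /=; rewrite in_itv/= -ler_norml leNgt xi.
  rewrite in_itv/= -ler_norml leNgt; apply/negP => xi; apply: xK.
  by exists i.
have cK : compact K.
  by apply: (@rV_compact R d (fun=> `[-1, 1]%classic)) => i; exact: segment_compact.
have K0 : K !=set0.
  by exists 0; apply/KP => -[j]; rewrite mxE normr0 ltr10.
have [c _ cmax] : exists2 c, c \in K &
    forall t, t \in K -> `|partials s h t| <= `|partials s h c|.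
  apply: (@EVT_max_rV _ _ (fun x => `|partials s h x|)) => //.
  apply: continuous_subspaceT => x.
  apply: (@continuous_comp _ _ _ (partials s h) Num.norm).
    exact: (hS s x I).1.
  exact: norm_continuous.
pose q := r - (size s)%:R.
exists (`|partials s h c| * (1 + Num.sqrt d%:R) `^ `|q|) => x.
have [xK|xK] := pselect (off_cube x).
  rewrite (partials_eq s open_off_cube h0 xK) partials0 normr0.
  by rewrite !mulr_ge0 ?powR_ge0.
have /cmax : x \in K by rewrite inE; apply/KP.
move=> /le_trans; apply; rewrite -mulrA ler_peMr//.
have e1 : 1 <= 1 + enorm x by rewrite lerDl enorm_ge0.
have e0 : 0 < 1 + enorm x by rewrite (lt_le_trans ltr01).
(* With B = 1 + sqrt d bounding 1 + |x| on the cube, (1 + |x|)^q is at least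
   (1 + |x|)^(-|q|), and B^|q| is at least (1 + |x|)^|q|: their product is >= 1. *)
rewrite (@le_trans _ _ ((1 + enorm x) `^ `|q| * (1 + enorm x) `^ (- `|q|)))//.
  by rewrite -powRD ?subrr ?powRr0// (gt_eqF e0) implybT.
rewrite ler_pM ?powR_ge0//.
  by rewrite ge0_ler_powR ?nnegrE ?addr_ge0 ?sqrtr_ge0 ?lerD2l ?cube_enorm.
by rewrite ler_powR// lerNl ler_normr lexx orbT.
Qed.

End RealSymbols.

(** * Functions cut off near the origin *)

Section CutoffProducts.
Variables (R : realType) (d : nat).
Implicit Types (g chi u : 'rV[R]_d -> R) (r : R).

Definition punctured : set 'rV[R]_d := [set x | x != 0].

Lemma open_punctured : open punctured.
Proof.
have -> : punctured = ~` [set 0] by apply/seteqP; split=> x /eqP.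
apply: closed_openC; apply: accessible_closed_set1; apply: hausdorff_accessible.
exact: norm_hausdorff.
Qed.

Lemma near_open (P : set 'rV[R]_d) x : (\forall y \near x, P y) ->
  exists2 V, open V /\ V x & V `<=` P.
Proof. by rewrite -nbhs_nearE nbhsE => -[V]; exists V. Qed.

(** Near the origin, where nothing is known of g, the product is zero; elsewhere
both factors are smooth. *)
Lemma smooth_flat_mul chi g : smooth_on setT chi ->
  (\forall x \near (0 : 'rV[R]_d), chi x = 0) -> smooth_on punctured g ->
  smooth_on setT (chi * g).
Proof.
move=> chiS /near_open[V [oV V0] chi0] gS s x _.
have [->|x0] := eqVneq x 0; last first.
  have chiS' : smooth_on punctured chi by move=> s' y _; exact: chiS.
  exact: (smoothM open_punctured chiS' gS s x0).
have : smooth_on V (chi * g); last by move=> /(_ s 0 V0).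
apply: (smooth_eq (g := cst 0)) => //; last exact: smooth_cst.
by move=> y Vy; rewrite /GRing.mul/= chi0// mul0r.
Qed.

Lemma pd_near0 chi i : (\forall x \near (0 : 'rV[R]_d), chi x = 0) ->
  \forall x \near (0 : 'rV[R]_d), pd i chi x = 0.
Proof.
move=> /near_open[V [oV V0] chi0]; apply: filterS (open_nbhs_nbhs (conj oV V0)) => x Vx.
by rewrite /pd (near_eq_derive _ (open_eq_near oV (h := cst 0) chi0 Vx)) derive_cst.
Qed.

(** At the origin the derivative of g is meaningless, but both sides vanish
there. *)
Lemma pd_flat_mul chi g i x : smooth_on setT chi ->
  (\forall x \near (0 : 'rV[R]_d), chi x = 0) -> smooth_on punctured g ->
  pd i (chi * g) x = pd i chi x * g x + chi x * pd i g x.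
Proof.
move=> chiS chi0 gS; have [->|x0] := eqVneq x 0; last first.
  have chiS' : smooth_on punctured chi by move=> s' y _; exact: chiS.
  by rewrite (pd_mul i chiS' gS x0) addrC mulrC.
have chig0 : \forall x \near (0 : 'rV[R]_d), (chi * g) x = 0.
  by apply: filterS chi0 => y; rewrite /GRing.mul/= => ->; rewrite mul0r.
rewrite (nbhs_singleton (pd_near0 i chig0)) (nbhs_singleton (pd_near0 i chi0)).
by rewrite (nbhs_singleton chi0) !mul0r addr0.
Qed.

Section Sums.
Variables (chi : 'rV[R]_d -> R) (us : nat -> 'rV[R]_d -> R).
Hypotheses (chiS : smooth_on setT chi)
  (chi0 : \forall x \near (0 : 'rV[R]_d), chi x = 0)
  (usS : forall j, smooth_on punctured (us j)).

Let sumS N : 'rV[R]_d -> R := fun x => \sum_(j < N) chi x * us j x.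

Lemma flat_sum_rec N : sumS N.+1 = sumS N + chi * us N.
Proof. by apply/funext => x; rewrite /sumS big_ord_recr. Qed.

Lemma flat_sum0 : sumS 0 = cst 0.
Proof. by apply/funext => x; rewrite /sumS big_ord0. Qed.

Lemma smooth_flat_sum N : smooth_on setT (sumS N).
Proof.
elim: N => [|N IHN]; first by rewrite flat_sum0; apply: smooth_cst; exact: openT.
rewrite flat_sum_rec.
exact: (smoothD openT IHN (smooth_flat_mul chiS chi0 (usS N))).
Qed.

Lemma pd_flat_sum N i x : pd i (sumS N) x =
  \sum_(j < N) (pd i chi x * us j x + chi x * pd i (us j) x).
Proof.
elim: N => [|N IHN]; first by rewrite flat_sum0 big_ord0 /pd derive_cst.
rewrite flat_sum_rec big_ord_recr/= -IHN -pd_flat_mul//.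
exact: (pd_add i (smooth_flat_sum N) (smooth_flat_mul chiS chi0 (usS N)) (I : setT x)).
Qed.

End Sums.

(** By the Leibniz rule, the new remainder is the derivative of the old one plus
the terms in which the derivative falls on chi.  Those are smooth and vanish off
the cube, where chi is constant, so they satisfy the estimates of every order. *)
Lemma remainder_pd r chi u (us : nat -> 'rV[R]_d -> R) N i : cutoff chi ->
  (forall j, smooth_on punctured (us j)) ->
  rsymbol r (fun x => u x - \sum_(j < N) chi x * us j x) ->
  rsymbol (r - 1) (fun x => pd i u x - \sum_(j < N) chi x * pd i (us j) x).
Proof.
move=> [chiS chi0 chi1] usS remS.
set rem := fun x => _ in remS.
pose S x := \sum_(j < N) chi x * us j x.
have SS : smooth_on setT S by exact: smooth_flat_sum.
have uE : u = rem + S by apply/funext => x; rewrite /rem /S /= fctE subrK.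
have -> : (fun x => pd i u x - \sum_(j < N) chi x * pd i (us j) x) =
    pd i rem + (fun x => \sum_(j < N) pd i chi x * us j x).
  apply/funext => x.
  rewrite {1}uE (pd_add i remS.1 SS (I : setT x)) pd_flat_sum//.
  by rewrite big_split/= -addrA addrK.
apply: rsymbolD; first exact: rsymbol_pd.
have dchiS : smooth_on setT (pd i chi) by exact: (smooth_partials [:: i]).
apply: compactly_supported_rsymbol.
  by apply: smooth_flat_sum => //; exact: pd_near0.
move=> x xoff; apply: big1 => j _.
suff -> : pd i chi x = 0 by rewrite mul0r.
have chiE : forall y, off_cube y -> chi y = cst 1 y by move=> y /off_cube_enorm/chi1.
by rewrite /pd (near_eq_derive _ (open_eq_near (@open_off_cube R d) chiE xoff)) derive_cst.
Qed.

End CutoffProducts.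

(** * Derivatives of classical symbols *)

Section ClassicalSymbols.
Variables (R : realType) (d : nat).
Implicit Types (f : 'rV[R]_d -> R[i]) (a : R[i]).

Definition cpd (i : 'I_d) f : 'rV[R]_d -> R[i] := fun x =>
  pd i (fun y => complex.Re (f y)) x +i* pd i (fun y => complex.Im (f y)) x.

Lemma pderivE (b : multiindex d) f : pderiv b f = foldr cpd f (mseq b).
Proof.
rewrite /pderiv; elim: (mseq b) => [|i s IHs]; last by rewrite /= -IHs.
by apply/funext => x /=; case: (f x).
Qed.

Lemma Re_subn a n : complex.Re (a - n%:R) = complex.Re a - n%:R.
Proof. by rewrite raddfB/= (raddfMn (@complex.Re R)). Qed.

Lemma cpow_sub1 (t : R) a : 0 < t -> t%:C * cpow t (a - 1) = cpow t a.
Proof.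
move=> t0; case: a => p q; rewrite /cpow /= subr0 powRD ?(gt_eqF t0) ?implybT//.
rewrite powRN powRr1 ?(ltW t0)//.
rewrite mulrA; congr (_ * _); rewrite -rmorphM /=; congr (_%:C).
by rewrite mulrC mulfVK// gt_eqF.
Qed.

Lemma smooth_is_derive (g : 'rV[R]_d -> R) i x : smooth_on (@punctured R d) g -> x != 0 ->
  is_derive x (delta_mx ord0 i) g (pd i g x).
Proof. by move=> gS x0; exact: derivableP (derivable_smooth gS x0). Qed.

(** Differentiating f (t x) = t^a f (x) in x gives
t (d_i f) (t x) = t^a (d_i f) (x).  As t^a is complex, it mixes the real and
imaginary parts of f. *)
Lemma pos_homogeneous_cpd a f i : csmooth_on (@punctured R d) f ->
  pos_homogeneous a f -> pos_homogeneous (a - 1) (cpd i f).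
Proof.
move=> [reS imS] fhom t x t0 x0.
have tx0 : t *: x != 0 by rewrite scaler_eq0 negb_or gt_eqF// x0.
have t0C : t%:C != 0 :> R[i] by rewrite eq_complex /= gt_eqF.
apply: (mulfI t0C); rewrite mulrA cpow_sub1//.
move cE : (cpow t a) => c; case: c cE => A B cE.
pose u y := complex.Re (f y); pose w y := complex.Im (f y).
have hom : forall y, y != 0 ->
    u (t *: y) = A * u y - B * w y /\ w (t *: y) = A * w y + B * u y.
  by move=> y y0; rewrite /u /w fhom// cE; case: (f y).
have nx := open_nbhs_nbhs (conj (@open_punctured R d) x0).
have du := is_derive_scale (smooth_is_derive i reS tx0).
have dw := is_derive_scale (smooth_is_derive i imS tx0).
have ux := smooth_is_derive i reS x0; have wx := smooth_is_derive i imS x0.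
have Eu : t * pd i u (t *: x) = A * pd i u x - B * pd i w x.
  have [_ <-] := du; have [_ <-] : is_derive x (delta_mx ord0 i)
    (A *: (u : 'rV[R]_d -> R) - B *: (w : 'rV[R]_d -> R)) (A * pd i u x - B * pd i w x).
    by apply: is_deriveB; exact: is_deriveZ.
  by apply: near_eq_derive; apply: filterS nx => y /hom[].
have Ew : t * pd i w (t *: x) = A * pd i w x + B * pd i u x.
  have [_ <-] := dw; have [_ <-] : is_derive x (delta_mx ord0 i)
    (A *: (w : 'rV[R]_d -> R) + B *: (u : 'rV[R]_d -> R)) (A * pd i w x + B * pd i u x).
    by apply: is_deriveD; exact: is_deriveZ.
  by apply: near_eq_derive; apply: filterS nx => y /hom[].
rewrite /cpd -/u -/w.
apply/eqP; rewrite eq_complex /= !mul0r subr0 addr0 Eu Ew.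
by rewrite !eqxx.
Qed.

(** The expansion of f may be differentiated term by term, with the same
cutoff: see [remainder_pd]. *)
Lemma classical_symbol_cpd a f i : classical_symbol a f ->
  classical_symbol (a - 1) (cpd i f).
Proof.
move=> [fS [chi [chiC [s [sP remS]]]]].
split.
  move/symbolP: fS => [reS imS]; apply/symbolP; rewrite (Re_subn _ 1).
  by split; exact: rsymbol_pd.
exists chi; split=> //; exists (fun j => cpd i (s j)); split=> [j|N].
  have [[reS imS] hom] := sP j; split.
    by split; exact: (smooth_partials [:: i]).
  by rewrite addrAC; exact: (pos_homogeneous_cpd i (conj reS imS) hom).
rewrite addrAC; apply/symbolP; rewrite (Re_subn _ 1).
move/symbolP: (remS N) => [reS imS].
have ReE (h : 'rV[R]_d -> R[i]) (k : nat -> 'rV[R]_d -> R[i]) :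
    (fun x => complex.Re (h x - \sum_(j < N) (chi x)%:C * k j x)) =
    (fun x => complex.Re (h x) - \sum_(j < N) chi x * complex.Re (k j x)).
  apply/funext => x; rewrite raddfB raddf_sum/=; congr (_ - _).
  by apply: eq_bigr => j _; case: (k j x) => p q /=; rewrite mul0r subr0.
have ImE (h : 'rV[R]_d -> R[i]) (k : nat -> 'rV[R]_d -> R[i]) :
    (fun x => complex.Im (h x - \sum_(j < N) (chi x)%:C * k j x)) =
    (fun x => complex.Im (h x) - \sum_(j < N) chi x * complex.Im (k j x)).
  apply/funext => x; rewrite raddfB raddf_sum/=; congr (_ - _).
  by apply: eq_bigr => j _; case: (k j x) => p q /=; rewrite mul0r addr0.
rewrite ReE in reS; rewrite ImE in imS.
have sS j : csmooth_on (@punctured R d) (s j) by have [] := sP j.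
have reD := remainder_pd i chiC (fun j => (sS j).1) reS.
have imD := remainder_pd i chiC (fun j => (sS j).2) imS.
split.
  exact: (eq_ind_r (rsymbol _) reD (ReE (cpd i f) (fun j => cpd i (s j)))).
exact: (eq_ind_r (rsymbol _) imD (ImE (cpd i f) (fun j => cpd i (s j)))).
Qed.

Lemma classical_symbol_pderiv a f b : classical_symbol a f ->
  classical_symbol (a - (mlen b)%:R) (pderiv b f).
Proof.
move=> fS; rewrite pderivE -size_mseq; elim: (mseq b) => [|i s IHs] /=.
  by rewrite subr0.
rewrite -addn1 natrD opprD addrA; exact: classical_symbol_cpd.
Qed.

Lemma CS_nonint_pderiv f b : CS_nonint f -> CS_nonint (pderiv b f).
Proof.
move=> [a [aZ fS]]; exists (a - (mlen b)%:R); split; last exact: classical_symbol_pderiv.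
move=> m; rewrite subr_eq; apply: contra (aZ (m + mlen b)) => /eqP ->.
by rewrite intrD.
Qed.

Lemma CS_lt_minus_d_pderiv f b : CS_lt_minus_d f -> CS_lt_minus_d (pderiv b f).
Proof.
move=> [a [ad fS]]; exists (a - (mlen b)%:R); split; last exact: classical_symbol_pderiv.
by rewrite Re_subn (le_lt_trans _ ad)// gerBl.
Qed.

Lemma CS_lt_pderiv f : CS_nonint f ->
  exists n, forall b, (n <= mlen b)%N -> CS_lt_minus_d (pderiv b f).
Proof.
move=> [a [_ fS]].
have [n an] : exists n : nat, complex.Re a + d%:R < n%:R.
  exists (Num.truncn `|complex.Re a + d%:R|).+1.
  by rewrite (le_lt_trans (ler_norm _))// truncnS_gt.
exists n => b nb; exists (a - (mlen b)%:R); split; last exact: classical_symbol_pderiv.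
rewrite Re_subn.
have : n%:R <= (mlen b)%:R :> R by rewrite ler_nat.
lra.
Qed.

End ClassicalSymbols.

(** * Polynomials vanishing at the integer points *)

Section PolynomialsOnGrids.
Variable F : numFieldType.

(** Linear functionals extracting the coefficients of a polynomial of degree
at most M from its values at 0, ..., M: they are given by the inverse of a
Vandermonde matrix. *)
Lemma moment_weights (M : nat) : exists w : 'I_M.+1 -> 'I_M.+1 -> F,
  forall m k : 'I_M.+1, \sum_n w m n * n%:R ^+ k = (m == k)%:R.
Proof.
pose V := Vandermonde M.+1 (\row_(n < M.+1) (n%:R : F)).
have Vunit : V \in unitmx.
  rewrite unitmxE unitfE det_Vandermonde; apply/prodf_neq0 => i _.
  apply/prodf_neq0 => j ij; rewrite !mxE subr_eq0 eqr_nat.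
  by rewrite gtn_eqF.
exists (fun m n => invmx V n m) => m k.
have /matrixP/(_ k m) := mulmxV Vunit; rewrite !mxE eq_sym => <-.
by apply: eq_bigr => n _; rewrite !mxE mulrC.
Qed.

(** Tensor products of the weights of [moment_weights] extract the coefficient
of any monomial whose exponents are at most M. *)
Lemma grid_poly_eq0 (d M : nat) (c : {ffun 'I_d -> 'I_M.+1} -> F) :
  (forall p : {ffun 'I_d -> 'I_M.+1},
     \sum_b c b * \prod_i (p i)%:R ^+ b i = 0) ->
  forall b, c b = 0.
Proof.
move=> c0 b0; have [w wP] := moment_weights M.
transitivity (\sum_b c b * \prod_i (b0 i == b i)%:R).
  rewrite (bigD1 b0)//= big1 => [|i _]; last by rewrite eqxx.
  rewrite mulr1 big1 ?addr0// => b bb0.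
  have [i /negbTE bi] : exists i, b0 i != b i.
    apply/existsP; apply: contraNT bb0 => /existsPn eqb.
    by apply/eqP/ffunP => i; have := eqb i; rewrite negbK => /eqP.
  by rewrite (bigD1 i)//= bi mul0r mulr0.
under eq_bigr => b _.
  under eq_bigr => i _ do rewrite -wP.
  rewrite (bigA_distr_bigA (fun i n => w (b0 i) n * n%:R ^+ b i)) mulr_sumr.
  over.
rewrite exchange_big big1// => p _.
under eq_bigr => b _ do rewrite big_split/= mulrCA.
by rewrite -mulr_sumr c0 mulr0.
Qed.

End PolynomialsOnGrids.

Section TaylorPolynomials.
Variables (R : realType) (d : nat).
Implicit Types (c : multiindex d -> R[i]) (F : multiindex d -> R[i]).

(** Written exactly as in the body of [sum_mlen], so that the two sums unify. *)
Definition mval n (b : {ffun 'I_d -> 'I_n}) : multiindex d := [ffun i => val (b i)].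

Lemma leq_mlen (b : multiindex d) i : (b i <= mlen b)%N.
Proof. by rewrite /mlen (bigD1 i)//= leq_addr. Qed.

(** The range of summation in [sum_mlen] depends on k.  A common range {0..M}^d
for all k <= M allows Taylor polynomials to be regarded as polynomials on a
grid. *)
Lemma sum_mlen_widen k M F : (k <= M)%N ->
  sum_mlen k F = \sum_(b : {ffun 'I_d -> 'I_M.+1} | mlen (mval b) == k) F (mval b).
Proof.
move=> kM.
pose h (b : {ffun 'I_d -> 'I_k.+1}) : {ffun 'I_d -> 'I_M.+1} := [ffun i => inord (b i)].
pose h' (b : {ffun 'I_d -> 'I_M.+1}) : {ffun 'I_d -> 'I_k.+1} := [ffun i => inord (b i)].
have hK b : h' (h b) = b.
  apply/ffunP => i; rewrite !ffunE; apply/val_inj.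
  by rewrite /= inordK inordK// (leq_trans (ltn_ord _)).
have hval b : mval (h b) = mval b.
  by apply/ffunP => i; rewrite !ffunE /= inordK// (leq_trans (ltn_ord _)).
rewrite (reindex_onto h h') => [|b /eqP bk].
  apply: eq_big => [b|b _]; last by rewrite hval.
  by rewrite hK eqxx andbT hval.
apply/ffunP => i; rewrite !ffunE; apply/val_inj => /=.
have := leq_mlen (mval b) i; rewrite bk ffunE /= => bik.
by rewrite !inordK.
Qed.

Lemma eq_sum_mlen k F G : (forall b, mlen b = k -> F b = G b) ->
  sum_mlen k F = sum_mlen k G.
Proof. by move=> FG; apply: eq_bigr => b /eqP; exact: FG. Qed.

Lemma sum_mlen0 F : sum_mlen 0 F = F (multi0 d).
Proof.
have E (b : {ffun 'I_d -> 'I_1}) : [ffun i => val (b i)] = multi0 d.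
  by apply/ffunP => i; rewrite !ffunE ord1.
rewrite /sum_mlen (big_pred1 [ffun=> ord0]) => [|b /=]; first by rewrite E.
rewrite E /mlen big1 => [|i _]; last by rewrite ffunE.
by rewrite eqxx; apply/esym/eqP/ffunP => i; rewrite ffunE ord1.
Qed.

(** The points of the grid {0..M}^d are integer points, and they already
determine the coefficients. *)
Lemma taylor_poly_eq0 M c :
  (forall p, (@integer_points R d) p ->
     \sum_(1 <= k < M.+1) sum_mlen k (fun b => c b * mcoef p b) = 0) ->
  forall b, (0 < mlen b <= M)%N -> c b = 0.
Proof.
move=> c0 b /andP[b0 bM].
(* The exponents range over the whole grid, which also contains multiindices of
   length above M; these get the coefficient 0. *)
pose a (b : {ffun 'I_d -> 'I_M.+1}) : R[i] :=
  if (0 < mlen (mval b) <= M)%N then c (mval b) / (mfact (mval b))%:R else 0.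
have a0 : forall b, a b = 0.
  apply: grid_poly_eq0 => p.
  pose q : 'rV[R]_d := \row_i (p i)%:R.
  rewrite -[RHS](c0 q); last first.
    by move=> i; rewrite mxE; exact: natr_int.
  rewrite big_nat.
  under eq_bigr => k /andP[_ kM].
    rewrite (sum_mlen_widen _ (M := M))// big_mkcond/=.
    over.
  rewrite -big_nat exchange_big/=; apply: eq_bigr => e _.
  rewrite /a; case: ifPn => [/andP[e0 eM]|eN].
    rewrite (bigD1_seq (mlen (mval e))) ?iota_uniq ?mem_index_iota ?e0//=.
    rewrite eqxx [X in _ = _ + X]big1 ?addr0 => [|k /negbTE ke]; last by rewrite eq_sym ke.
    rewrite mulrAC -mulrA; congr (_ * _).
    rewrite /mcoef rmorphM fmorphV /= rmorph_nat /mpow (rmorph_prod (real_complex R)); congr (_ / _).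
    by apply: eq_bigr => i _; rewrite mxE ffunE rmorphXn rmorph_nat.
  rewrite mul0r big_nat big1// => k /andP[k0 kM]; case: eqP => // ek.
  by move: eN; rewrite ek k0 -ltnS kM.
pose e : {ffun 'I_d -> 'I_M.+1} := [ffun i => inord (b i)].
have eb : mval e = b.
  apply/ffunP => i; rewrite !ffunE /= inordK//.
  by rewrite ltnS (leq_trans (leq_mlen b i)).
have := a0 e; rewrite /a eb b0 bM => /eqP; rewrite mulf_eq0 invr_eq0 pnatr_eq0.
rewrite orbC; case: eqP => [b1|_ /eqP//].
suff : (0 < mfact b)%N by rewrite b1.
by apply: prodn_gt0 => i; exact: fact_gt0.
Qed.

End TaylorPolynomials.

(** * Translation invariant forms *)

Section TranslationInvariantForms.
Variables (R : realType) (d : nat).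
Implicit Types (f : 'rV[R]_d -> R[i]) (b : multiindex d).

Lemma mlen_gt0 b : b <> multi0 d -> (0 < mlen b)%N.
Proof.
move=> b0; rewrite lt0n; apply/eqP => /eqP; rewrite sum_nat_eq0 => /forallP bi0.
by apply: b0; apply/ffunP => i; rewrite ffunE; apply/eqP; exact: bi0.
Qed.

Lemma pderiv_multi0 f : pderiv (multi0 d) f = f.
Proof.
suff E : mseq (multi0 d) = [::] by rewrite pderivE E.
apply/size0nil; rewrite size_mseq /mlen big1// => i _; exact: ffunE.
Qed.

Lemma mcoef_multi0 (p : 'rV[R]_d) : mcoef p (multi0 d) = 1.
Proof.
rewrite /mcoef /mpow /mfact !big1 ?divr1// => i _; rewrite ffunE//.
Qed.

Variable rho : ('rV[R]_d -> R[i]) -> R[i].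

(** For f of order below -d, lambda agrees with rho on all derivatives of f.
Hence the invariance of lambda says that all terms of Taylor's formula for rho,
except the one of order 0, add up to 0. *)
Lemma rho_translate lambda f (p : 'rV[R]_d) : taylor_compatible rho ->
  restricts_to lambda rho -> translation_invariant setT rho lambda ->
  CS_nonint f -> CS_lt_minus_d f -> rho (translate p f) = rho f.
Proof.
move=> hT res inv fZ fL; have [N /(_ N (leqnn N) p I) invN] := inv f fZ.
have [_ ->] := hT f fL N p.
rewrite big_nat_recl//= sum_mlen0 pderiv_multi0 mcoef_multi0 mulr1.
rewrite -addrA -[RHS]addr0; congr (_ + _); rewrite -[RHS]invN; congr (_ + _).
rewrite big_add1 /=; apply: eq_bigr => k _; apply: eq_sum_mlen => b _.
rewrite res//; first exact: CS_nonint_pderiv.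
exact: CS_lt_minus_d_pderiv.
Qed.

(** The polynomial to which [taylor_poly_eq0] is applied has degree N + 1: its
terms of degree N + 1 are the remainder, whose integrands do not depend on p
by [rho_translate]. *)
Lemma vanishes_on_derivatives lambda b f : taylor_compatible rho ->
  restricts_to lambda rho -> translation_invariant setT rho lambda ->
  b <> multi0 d -> CS_nonint f -> lambda (pderiv b f) = 0.
Proof.
move=> hT res inv b0 fZ.
have [N0 invf] := inv f fZ; have [n fL] := CS_lt_pderiv fZ.
(* N is large enough for the invariance at f, for derivatives of order N + 1 to
   have order below -d, and for b to occur in the polynomial. *)
pose N := maxn (maxn N0 n) (mlen b).
have N0N : (N0 <= N)%N by rewrite /N -maxnA leq_maxl.
have nN : (n <= N)%N by rewrite /N maxnAC -maxnA leq_max leq_maxr orbT.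
have bN : (mlen b <= N)%N by rewrite leq_maxr.
(* Once the integrals in the remainder no longer depend on p, K e is the
   coefficient of p^e / e! in the remainder. *)
pose K e : R[i] := N.+1%:R *
  integral01 (fun t => ((1 - t) ^+ N)%:C * rho (pderiv e f)).
pose c e := if (mlen e <= N)%N then lambda (pderiv e f) else K e.
suff : c b = 0 by rewrite /c bN.
apply: (@taylor_poly_eq0 R d N.+1); last by rewrite mlen_gt0// (leq_trans bN).
move=> p _; rewrite -[RHS](invf N N0N p I) big_nat_recr//=; congr (_ + _).
  rewrite !big_nat; apply: eq_bigr => k /andP[_ kN]; apply: eq_sum_mlen => e ek.
  by rewrite /c ek -ltnS kN.
rewrite /taylor_remainder /sum_mlen mulr_sumr; apply: eq_bigr => e' /eqP.
move: [ffun i => val (e' i)] => e eN.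
rewrite /c eN ltnn /K mulrA [X in _ = X]mulrAC; congr (_ * integral01 _ * _).
apply/funext => t; rewrite /remainder_integrand; congr (_ * _).
apply/esym; apply: (rho_translate (lambda := lambda)) => //.
  exact: CS_nonint_pderiv.
by apply: fL; rewrite eN (leq_trans nN).
Qed.

(** The remainders of the two forms cancel, as they depend on rho only. *)
Lemma determined_on_derivatives lambda1 lambda2 b f :
  translation_invariant (@integer_points R d) rho lambda1 ->
  translation_invariant (@integer_points R d) rho lambda2 ->
  b <> multi0 d -> CS_nonint f -> lambda1 (pderiv b f) = lambda2 (pderiv b f).
Proof.
move=> inv1 inv2 b0 fZ.
have [N1 inv1f] := inv1 f fZ; have [N2 inv2f] := inv2 f fZ.
pose N := maxn (maxn N1 N2) (mlen b).
have N1N : (N1 <= N)%N by rewrite /N -maxnA leq_maxl.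
have N2N : (N2 <= N)%N by rewrite /N maxnAC -maxnA leq_max leq_maxr orbT.
apply/eqP; rewrite -subr_eq0; apply/eqP.
apply: (@taylor_poly_eq0 R d N (fun e => lambda1 (pderiv e f) - lambda2 (pderiv e f)));
  last by rewrite mlen_gt0// leq_maxr.
move=> p pZ.
have /addIr E := etrans (inv1f N N1N p pZ) (esym (inv2f N N2N p pZ)).
rewrite -[RHS](subrr (\sum_(1 <= k < N.+1)
  sum_mlen k (fun e : multiindex d => lambda2 (pderiv e f) * mcoef p e))).
rewrite -{1}E -sumrB; apply: eq_bigr => k _; rewrite -sumrB; apply: eq_bigr => e _.
exact: mulrBl.
Qed.

End TranslationInvariantForms.

Theorem proposition1 (R : realType) (d : nat)
    (rho : ('rV[R]_d -> R[i]) -> R[i])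
    (hrho : L1_linear_form rho) (hT : taylor_compatible rho) :
  (forall lambda : ('rV[R]_d -> R[i]) -> R[i],
     CS_nonint_linear_form lambda -> restricts_to lambda rho ->
     translation_invariant setT rho lambda ->
     forall (b : multiindex d) (sigma : 'rV[R]_d -> R[i]),
       b <> multi0 d -> CS_nonint sigma -> lambda (pderiv b sigma) = 0) /\
  (forall lambda1 lambda2 : ('rV[R]_d -> R[i]) -> R[i],
     CS_nonint_linear_form lambda1 -> restricts_to lambda1 rho ->
     translation_invariant (@integer_points R d) rho lambda1 ->
     CS_nonint_linear_form lambda2 -> restricts_to lambda2 rho ->
     translation_invariant (@integer_points R d) rho lambda2 ->
     forall (b : multiindex d) (sigma : 'rV[R]_d -> R[i]),
       b <> multi0 d -> CS_nonint sigma ->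
       lambda1 (pderiv b sigma) = lambda2 (pderiv b sigma)).
Proof.
split=> [lambda _ res inv b f|l1 l2 _ _ inv1 _ _ inv2 b f].
  exact: (vanishes_on_derivatives hT res inv).
exact: (determined_on_derivatives inv1 inv2).
Qed.
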